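(* Let $X$ be a Tychonoff space. The following are equivalent: (1) $C_{\Gamma}(X)$ is completely metrizable; (2) $C_{\Gamma}(X)$ is Čech complete; (3) $C_{\Gamma}(X)$ is sieve complete; (4) $C_{\Gamma}(X)$ is hereditarily Baire; (5) $X$ is countably compact.
   Context: $C(X)$ is the set of all continuous functions $f:X\to\mathbb R$ ($\mathbb R$ with its usual topology). The graph topology $\tau_{\Gamma}$ on $C(X)$ is the topology generated by the sets $F_U=\{f\in C(X): \text{graph}(f)\subseteq U\}$, where $U$ ranges over all nonempty open subsets of $X\times\mathbb R$; $C_{\Gamma}(X)$ denotes the space $(C(X),\tau_{\Gamma})$. A Tychonoff space is Čech complete if it is a $G_{\delta}$-subspace of a compactification of it. A space is sieve complete if it is a continuous open image of a Čech complete space. A space is a Baire space if every countable collection of dense open sets has dense intersection. A space $Z$ is hereditarily Baire if every nonempty closed subspace of $Z$ is a Baire space. *)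

(* Defs.v *)
From HB Require Import structures.
From mathcomp Require Import all_boot all_order all_algebra.
From mathcomp Require Import all_classical all_reals topology normedtype.
From mathcomp Require Import borel_hierarchy.

Set Implicit Arguments.
Unset Strict Implicit.
Unset Printing Implicit Defensive.

Import Order.TTheory GRing.Theory Num.Theory.
Import numFieldTopology.Exports.

Local Open Scope classical_set_scope.
Local Open Scope ring_scope.

Section GraphTopology.
Context (X : topologicalType) (R : realType).

Definition graph (f : X -> R) : set (X * R) := [set p | p.2 = f p.1].

(* A synonym, since [continuousType X R] carries other topologies
   (pointwise, uniform, compact-open) in function_spaces. *)
Definition C_Gamma : Type := continuousType X R.

HB.instance Definition _ := Choice.copy C_Gamma (continuousType X R).

HB.instance Definition _ := @isSubBaseTopological.Build C_Gamma
  (set (X * R)) [set U | open U /\ U !=set0]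
  (fun U => [set f : continuousType X R | graph f `<=` U]).

End GraphTopology.

Section Properties.
Implicit Types (Z K : topologicalType).

Definition tychonoff_space Z :=
  accessible_space Z /\ completely_regular_space Z.

(* [m] is a metric structure on the carrier of [Z] inducing the topology of [Z].
   Completeness is the axiom of the class [Complete], which also asks for a
   distinguished point. *)
Definition completely_metrizable (R : realType) Z :=
  exists m : Metric R Z, let M : metricType R := Metric.Pack m in
    @open M = @open Z /\
    forall F : set_system M, ProperFilter F -> cauchy F -> exists x : M, F --> x.

Definition embedding Z K (e : Z -> K) :=
  injective e /\
  forall A : set Z, open A <-> exists2 V : set K, open V & A = e @^-1` V.

Definition compactification Z K (e : Z -> K) :=
  [/\ compact [set: K], hausdorff_space K, embedding e & dense (range e)].

Definition cech_complete Z :=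
  tychonoff_space Z /\
  exists (K : topologicalType) (e : Z -> K),
    compactification e /\ Gdelta (range e).

Definition sieve_complete Z :=
  exists (Y : topologicalType) (f : Y -> Z),
    [/\ cech_complete Y, continuous f,
        forall A : set Y, open A -> open (f @` A) & range f = [set: Z]].

Definition baire_space Z :=
  forall F : nat -> set Z, (forall n, open (F n) /\ dense (F n)) ->
    dense (\bigcap_n F n).

Definition hereditarily_baire Z :=
  forall A : set Z, closed A -> A !=set0 -> baire_space (set_type A).

Definition countably_compact Z :=
  forall U : nat -> set Z, (forall n, open (U n)) ->
    \bigcup_n U n = [set: Z] -> finite_subset_cover [set: nat] U [set: Z].

End Properties.

(* Main.v *)
(* (1) => (2): embed a complete metric space in [R ^ Z] by sending [x] to
   [z |-> min 1 (d x z)]; in the closure of the image, which is compact, a point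
   [p] belongs to the image iff the values of [p] come arbitrarily close to [0],
   for then the trace of its neighbourhoods on the space is a Cauchy filter.
   (3) => (4): a closed subspace pulls back to a closed set of the Cech complete
   space, where the Baire category argument is run in its compactification.
   (4) => (5): if [X] is not countably compact, it contains a locally finite
   sequence [x_n]. The functions vanishing at almost all [x_n] form a closed
   subspace, the countable union of the closed sets of functions vanishing at
   [x_k] for all [k >= n], and these have empty interior in it.
   (5) => (1): an open set containing a graph contains a uniform tube around it,
   so the graph topology is that of uniform convergence. *)

Require Import Defs.
From HB Require Import structures.
From mathcomp Require Import all_boot all_order all_algebra.
From mathcomp Require Import all_classical all_reals interval_inference.
From mathcomp Require Import topology normedtype.
From mathcomp Require Import borel_hierarchy finmap lra.

Set Implicit Arguments.
Unset Strict Implicit.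
Unset Printing Implicit Defensive.

Import Order.TTheory GRing.Theory Num.Theory.
Import numFieldNormedType.Exports.

Local Open Scope classical_set_scope.
Local Open Scope ring_scope.

(** * Compactifications obtained from embeddings *)

Definition closure_corestrict (Z T : topologicalType) (j : Z -> T) (z : Z) :
    set_type (closure (range j)) :=
  SigSub (mem_set (subset_closure (imageT j z))).

(** The closure carries the initial topology of [set_val], so cluster points, separation and traces
    of open sets are all inherited from [T]. *)
Lemma embedding_compactification (Z T : topologicalType) (j : Z -> T) :
  hausdorff_space T -> compact (closure (range j)) -> embedding j ->
  compactification (closure_corestrict j).
Proof.
move=> hT cj [j_inj j_emb]; set C := closure (range j).
have valc : continuous (set_val : set_type C -> T) by exact: initial_continuous.
split.
- move=> F PF _.
  have [|p [Cp Fp]] := cj (set_val @ F) (fmap_proper_filter _ PF).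
    by apply: (@filterS _ F _ setT _ _ filterT) => x _; exact: set_valP.
  exists (SigSub (mem_set Cp)); split => // A N FA [_ [[W oW <-] Wp] WN].
  have [_ [[a Aa <-] Wa]] : set_val @` A `&` W !=set0.
    apply: Fp; last by exact: open_nbhs_nbhs.
    by apply: (@filterS _ F _ A) => // a Aa; exists a.
  by exists a; split => //; exact: WN.
- move=> p q pq; apply: val_inj; apply: hT => A B /valc pA /valc qB.
  by have [r [Ar Br]] := pq _ _ pA qB; exists (val r).
- split; first by move=> x y /(congr1 val); exact: j_inj.
  move=> A; split.
    by move=> /j_emb[W oW AW]; exists (set_val @^-1` W) => //; exists W.
  by move=> [_ [W oW <-] AW]; apply/j_emb; exists W.
- move=> O [o Oo] [W oW WO].
  have Wo : W (val o) by move: Oo; rewrite -WO.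
  have [_ [[z _ <-] Wz]] := set_valP o W (open_nbhs_nbhs (conj oW Wo)).
  by exists (closure_corestrict j z); split; [rewrite -WO|exists z].
Qed.

(** * The compactification of a complete metric space *)

Section MetricCompactification.
Context (R : realType) (M : metricType R).

(** Truncation at 1 keeps the image in the cube of [[0, 1]]-valued functions, compact by Tychonoff's
    theorem. *)
Definition dist_embedding (x : M) : {ptws M -> R} :=
  fun z => Num.min 1 (mdist x z).

Let proj_cont z : continuous (fun p : {ptws M -> R} => p z).
Proof. exact: (@proj_continuous M (fun=> R) z). Qed.

Let open_coord_lt z r : open [set p : {ptws M -> R} | p z < r].
Proof.
apply: (@open_comp _ _ (fun p : {ptws M -> R} => p z) [set s | s < r]).
  by move=> p _; exact: proj_cont.
exact: open_lt.
Qed.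

Let ptws_hausdorff : hausdorff_space {ptws M -> R}.
Proof. by apply: hausdorff_product => _; exact: Rhausdorff. Qed.

(** Each coordinate is 1-Lipschitz in [x]. *)
Lemma dist_embedding_continuous : continuous dist_embedding.
Proof.
move=> x; apply/pointwise_cvgP => z; apply/cvgrPdist_lt => e e0.
have : nbhs x (ball x e) by exact: nbhsx_ballx.
apply: filterS => y; rewrite ballEmdist /= => xy; rewrite /dist_embedding.
have := metric_triangle x y z; have := metric_triangle y x z.
rewrite (metric_sym y x); move: (mdist x y) (mdist x z) (mdist y z) xy.
move=> a b c ae ba ab.
have := mdist_ge0 x y.
rewrite ltr_norml !minElt; do ?case: ifPn => ?; lra.
Qed.

Lemma embedding_dist_embedding : embedding dist_embedding.
Proof.
split.
  move=> x y /(congr1 (fun p => p y)); rewrite /dist_embedding mdistxx.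
  rewrite (min_r ler01) => mxy; apply: mdist_positivity.
  by move: mxy; rewrite minElt; case: ifPn => // _ /eqP; rewrite oner_eq0.
move=> A; split; last first.
  by move=> [V oV ->]; apply: open_comp => // x _;
    exact: dist_embedding_continuous.
move=> oA.
(* On the image, [B (x, e)] cuts out the ball around [x] of radius [min 1 e]. *)
pose B (xe : M * R) := [set p : {ptws M -> R} | p xe.1 < Num.min 1 xe.2].
exists (\bigcup_(xe in [set xe : M * R | 0 < xe.2 /\ ball xe.1 xe.2 `<=` A])
  B xe).
  by apply: bigcup_open => xe _; exact: open_coord_lt.
apply/seteqP; split => [x Ax|y [[x e] [/= e0 xeA]]].
  have /nbhs_ballP[e /= e0 eA] := open_nbhs_nbhs (conj oA Ax).
  exists (x, e) => //; rewrite /B/= /dist_embedding mdistxx.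
  by rewrite (min_r ler01) lt_min ltr01.
rewrite /B/= /dist_embedding => yx; apply: xeA; rewrite ballEmdist/= metric_sym.
by move: yx; rewrite lt_min !gt_min ltxx/= => /andP[y1 /orP[|//]]; lra.
Qed.

Lemma compact_closure_dist_embedding : compact (closure (range dist_embedding)).
Proof.
pose C := [set p : {ptws M -> R} | forall z, `[0, 1]%classic (p z)].
have cC : compact C.
  by apply: (@tychonoff M (fun=> R) (fun=> `[0, 1]%classic)) => _;
    exact: segment_compact.
have /closure_id CE : closed C.
  exact: compact_closed cC.
apply: subclosed_compact cC _; first exact: closed_closure.
rewrite CE; apply: closureS => _ [x _ <-] z /=.
by rewrite in_itv/= /dist_embedding le_min ler01 mdist_ge0 ge_min lexx.
Qed.

Lemma Gdelta_dist_embedding :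
  (forall F : set_system M, ProperFilter F -> cauchy F ->
    exists x : M, F --> x) ->
  Gdelta (range (closure_corestrict dist_embedding)).
Proof.
move=> complM; set K := set_type (closure (range dist_embedding)).
set e := closure_corestrict _.
have open_val_lt z r : open [set p : K | (val p : {ptws M -> R}) z < r].
  by exists [set p : {ptws M -> R} | p z < r] => //; exact: open_coord_lt.
have [_ hK [_ e_emb] de] := embedding_compactification ptws_hausdorff
  compact_closure_dist_embedding embedding_dist_embedding.
exists (fun n => \bigcup_z
    [set p : K | (val p : {ptws M -> R}) z < n.+1%:R^-1]).
  by move=> n; apply: bigcup_open => z _; exact: open_val_lt.
apply/seteqP; split => [_ [x _ <-] n _|p Gp].
  by exists x => //=; rewrite /dist_embedding mdistxx (min_r ler01).
(* The traces of the neighbourhoods of [p]; density of the range keeps them nonempty. *)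
pose F : set_system M := filter_from (nbhs p) (fun W => e @^-1` W).
have PF : ProperFilter F.
  apply: filter_from_proper.
    apply: filter_from_filter; first by exists setT; exact: filterT.
    by move=> A B pA pB; exists (A `&` B) => //; exact: filterI.
  move=> W; rewrite nbhsE => -[V [oV Vp] VW].
  have [|q [Vq [z _ zq]]] := de V _ oV; first by exists p.
  by rewrite -zq in Vq; exists z; exact: VW.
have [|x Fx] := complM F PF.
  apply: cauchy_exP => r r0.
  (* Below 1 the truncated distance is the true distance. *)
  have m0 : 0 < Num.min r 1 by rewrite lt_min r0 ltr01.
  have [n _ /(_ n (leqnn n)) nr] := near_infty_natSinv_lt (PosNum m0).
  have [z _ pz] := Gp n I.
  exists z, [set q : K | (val q : {ptws M -> R}) z < n.+1%:R^-1].
    exact: open_nbhs_nbhs.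
  move=> y; rewrite ballEmdist /e /= /dist_embedding metric_sym.
  move=> /lt_trans/(_ nr); rewrite /= lt_min !gt_min ltxx/=.
  by move=> /andP[/orP[yr|//] y1]; lra.
(* [p] is [e x], since no open sets separate them: some neighbourhood [W] of [p] has its trace
   inside that of [A'], and by density an [e z] lies in both [W] and [B']. *)
exists x => //; apply: hK => A B; rewrite !nbhsE.
move=> -[A' [oA' A'x] AA'] [B' [oB' B'p] BB'].
have /Fx[W Wp WA] : nbhs x (e @^-1` A').
  by apply: open_nbhs_nbhs; split => //; apply/e_emb; exists A'.
have [|q [[Wq Bq] [z _ zq]]] := de (W° `&` B') _ (openI (open_interior _) oB').
  by exists p.
rewrite -zq in Wq Bq; exists (e z); split; last exact: BB'.
by apply: AA'; apply: WA; exact: interior_subset Wq.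
Qed.

End MetricCompactification.

Lemma completely_metrizable_cech_complete (R : realType) (Z : topologicalType) :
  completely_metrizable R Z -> cech_complete Z.
Proof.
move=> [m [oE complM]]; set M := Metric.Pack m in oE complM.
have nbE (x : Z) : @nbhs M M x `<=` @nbhs Z Z x.
  move=> A; rewrite (@nbhsE M) => -[B [oB Bx] BA].
  apply: (filterS BA); apply: open_nbhs_nbhs; split => //.
  by move: oB; rewrite oE.
split.
  split.
    move=> x y /eqP xy.
    have xyM : (x : M) != y by exact/eqP.
    have [A [oA xA yA]] := hausdorff_accessible (@metric_hausdorff R M) xyM.
    by exists A; split => //; move: oA; rewrite oE.
  move=> a B cB nBa.
  have cMB : @closed M B.
    rewrite -[B]setCK; apply: open_closedC; rewrite oE; exact: closed_openC.
  (* Complete regularity asks for a uniformity coarser than the topology; the one found on [M]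
     serves by [nbE]. *)
  have [uT [E [entE BE nE]]] := @point_uniform_separator R M a B cMB nBa.
  by exists uT, E; split => // x; apply: subset_trans (nbE x); exact: nE.
exists (set_type (closure (range (@dist_embedding R M)))).
exists (closure_corestrict (@dist_embedding R M)); split.
  have [|cK hK [e_inj e_emb] de] := embedding_compactification _
    (@compact_closure_dist_embedding R M) (@embedding_dist_embedding R M).
    by apply: hausdorff_product => _; exact: Rhausdorff.
  by split => //; split => // A; rewrite -oE; exact: e_emb.
exact: Gdelta_dist_embedding.
Qed.

(** * Baire category in Cech complete spaces and their open images *)

(** Density relative to [B] is phrased with subsets of [Y], so that it applies directly to
    preimages. Nested open sets of [K] shrink into each [G n] and [V n] while meeting the image of
    [B]; a cluster point lies in every [G n], hence in the range of [e]. *)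
Lemma cech_complete_closed_baire (Y : topologicalType) (B : set Y)
    (D : nat -> set Y) (O : set Y) :
  cech_complete Y -> closed B -> (forall n, open (D n)) ->
  (forall n U, open U -> U `&` B !=set0 -> U `&` D n `&` B !=set0) ->
  open O -> O `&` B !=set0 -> O `&` (\bigcap_n D n) `&` B !=set0.
Proof.
move=> [_ [K [e [[cK hK [e_inj e_emb] _] [G oG eG]]]]] cB oD dD oO OB.
have /choice[V VP] n : exists V : set K, open V /\ D n = e @^-1` V.
  by have /e_emb[V ? ?] := oD n; exists V.
have [W0 oW0 OW0] : exists2 W : set K, open W & O = e @^-1` W by exact/e_emb.
pose P (W : set K) := open W /\ W `&` e @` B !=set0.
(* The hypothesis [P W] sits under the existential so that choice yields a total [g]. *)
have step n W : exists W' : set K,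
    P W -> P W' /\ closure W' `<=` W `&` G n `&` V n.
  have [[oW [p [Wp [y By yp]]]]|nP] := pselect (P W); last by exists W.
  have [||z [[Wz Dz] Bz]] := dD n (e @^-1` W).
  - by apply/e_emb; exists W.
  - by exists y; split => //; rewrite /preimage/= yp.
  have [oV DV] := VP n.
  have : nbhs (e z) (W `&` G n `&` V n).
    apply: open_nbhs_nbhs; split; first by do 2 apply: openI => //.
    split; [split => //|by move: Dz; rewrite DV].
    have : range e (e z) by exists z.
    by rewrite eG => /(_ n I).
  move/(@compact_regular K (e z) setT hK cK filterT) => [N Nz NW].
  exists N° => _; split; last first.
    by apply: subset_trans NW; apply: closureS; exact: interior_subset.
  split; first exact: open_interior.
  by exists (e z); split; [exact: Nz|exists z].
have /choice[g gP] (nW : nat * set K) := step nW.1 nW.2.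
pose W := fix W n := if n is m.+1 then g (m, W m) else W0.
have PW n : P (W n).
  elim: n => [|n /(gP (n, _))[]//]; split => //.
  have [y [Oy By]] := OB; exists (e y).
  by split; [move: Oy; rewrite OW0|exists y].
have WS n : closure (W n.+1) `<=` W n `&` G n `&` V n.
  by have [] := gP (n, W n) (PW n).
have Wle m n : (m <= n)%N -> W n `<=` W m.
  elim: n => [|n IH]; first by rewrite leqn0 => /eqP->.
  rewrite leq_eqVlt => /predU1P[->//|/IH]; apply: subset_trans.
  by move=> x /subset_closure/WS[[]].
pose F := filter_from [set: nat] (fun n => W n `&` e @` B).
have PF : ProperFilter F.
  apply: filter_from_proper; last by move=> n _; have [] := PW n.
  apply: filter_from_filter; first by exists 0%N.
  move=> m n _ _; exists (maxn m n) => // x [Wx eBx].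
  by split; split => //; apply: Wle Wx; rewrite ?leq_maxl ?leq_maxr.
have [p [_ Fp]] := cK F PF filterT.
have clp n : closure (W n `&` e @` B) p.
  by move=> N Np; apply: Fp => //; exists n.
have Wp n : (W n `&` G n `&` V n) p.
  by apply: WS; apply: closureS (clp n.+1) => x [].
have [y _ yp] : range e p by rewrite eG => n _; have [[]] := Wp n.
exists y; split.
  split; first by rewrite OW0 /preimage/= yp; have [[]] := Wp 0%N.
  by move=> n _; have [_ ->] := VP n; rewrite /preimage/= yp; have [] := Wp n.
(* Otherwise the complement of [B] is the trace of an open set around [p], which must meet the image
   of [B]. *)
apply: contrapT => nBy.
have /e_emb[U oU BU] : open (~` B) by exact: closed_openC.
have Uy : (e @^-1` U) y by rewrite -BU.
have : nbhs p U by apply: open_nbhs_nbhs; split => //; rewrite -yp.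
move=> /(clp 0%N)[_ [[_ [b Bb <-]] Ub]].
by have : (~` B) b by rewrite BU.
Qed.

(** Density pulls back because [f] is open: an open [U] meeting the preimage of [A] has an open
    image meeting [A], which therefore meets each [F' n] within [A]. *)
Lemma sieve_complete_hereditarily_baire (Z : topologicalType) :
  sieve_complete Z -> hereditarily_baire Z.
Proof.
move=> [Y [f [cY fc fo fs]]] A cA _ F oF.
have /choice[F' FE] n : exists V : set Z, open V /\ set_val @^-1` V = F n.
  by have [[V oV VF] _] := oF n; exists V.
move=> O [a Oa] [O' oO' OE].
have [y _ ya] : range f (val a) by rewrite fs.
have fcont U : open U -> open (f @^-1` U) by move=> oU; exact: open_comp.
have [] := @cech_complete_closed_baire Y (f @^-1` A) (fun n => f @^-1` F' n)
  (f @^-1` O') cY.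
- exact: preimage_closed.
- by move=> n; apply: fcont; have [] := FE n.
- move=> n U oU [u [Uu Au]].
  have [_ dF] := oF n.
  have [||b [[v Uv vb] Fb]] := dF (set_val @^-1` (f @` U)).
  + by exists (SigSub (mem_set (Au : A (f u)))); exists u.
  + by exists (f @` U) => //; exact: fo.
  exists v; split; first split => //.
    by move: Fb; have [_ <-] := FE n; rewrite /preimage/= vb.
  by rewrite /preimage/= vb; exact: set_valP.
- exact: fcont.
- exists y; split; rewrite /preimage/= ya; last exact: set_valP.
  by move: Oa; rewrite -OE.
move=> v [[Ov Fv] Av]; exists (SigSub (mem_set (Av : A (f v)))); split.
  by rewrite -OE.
by move=> n _; have [_ <-] := FE n; exact: Fv.
Qed.

(** * Basic open sets of the graph topology *)

Section GraphTopologyFacts.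
Context (X : topologicalType) (R : realType).
Implicit Types (f : C_Gamma X R) (U : set (X * R)).

(** The subbase admits only nonempty [U]. For empty [U] the set is empty if [X] has a point, and the
    whole space if [X] is empty. *)
Lemma open_graph_subset U :
  open U -> open [set f : C_Gamma X R | graph f `<=` U].
Proof.
move=> oU; have [->|/set0P U0] := eqVneq U set0; last first.
  exists [set [set f : C_Gamma X R | graph f `<=` U]];
    last by rewrite bigcup_set1.
  move=> _ ->; exists [fset U]%fset; last by rewrite set_fset1 bigcap_set1.
  by move=> V; rewrite inE => /eqP->; apply/mem_set.
have [[x _]|X0] := pselect (exists x : X, True).
  suff -> : [set f : C_Gamma X R | graph f `<=` set0] = set0 by exact: open0.
  by apply/seteqP; split => // f /(_ (x, f x)); exact.
suff -> : [set f : C_Gamma X R | graph f `<=` set0] = setT by exact: openT.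
by apply/seteqP; split => // f _ [x r]; exfalso; apply: X0; exists x.
Qed.

(** A graph lies in finitely many open sets iff it lies in their intersection, so the subbase is
    already a base. *)
Lemma graph_nbhs_base (O : set (C_Gamma X R)) f : open O -> O f ->
  exists2 U, open U &
    graph f `<=` U /\ [set g : C_Gamma X R | graph g `<=` U] `<=` O.
Proof.
move=> [D sD <-] [B DB Bf]; have [E sE EB] := sD _ DB.
exists (\bigcap_(V in [set` E]) V).
  rewrite openE => p Ep; apply: filter_bigI => V VE.
  have /set_mem[oV _] := sE _ VE.
  by apply: open_nbhs_nbhs; split => //; exact: Ep.
split.
  have : B f by []; rewrite -EB => fE p fp V VE.
  exact: (fE V VE p fp).
move=> g gE; suff Bg : B g by exists B.
by rewrite -EB => V VE p gp; exact: (gE p gp).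
Qed.

Lemma open_X_nbhs_rect U x r : open U -> U (x, r) ->
  exists V (e : R), [/\ open V, V x, 0 < e & V `*` ball r e `<=` U].
Proof.
rewrite openE => oU /oU[[P Q] /= [xP rQ] PQU].
have [e e0 eQ] := (iffLR (nbhs_ballP r Q)) rQ.
exists P°, e; split => //; first exact: open_interior.
by move=> [y s] [/interior_subset yP /eQ sQ]; exact: PQU.
Qed.

End GraphTopologyFacts.

(** * From hereditarily Baire to countably compact *)

Lemma accessible_prod (X Y : topologicalType) :
  accessible_space X -> accessible_space Y -> accessible_space (X * Y)%type.
Proof.
move=> aX aY [x y] [x' y']; rewrite xpair_eqE negb_and.
move=> /orP[/aX|/aY] [A [oA /set_mem As /set_mem At]].
  exists (fst @^-1` A); split; [|exact/mem_set|exact/mem_set].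
  by apply: open_comp => // p _; exact: cvg_fst.
exists (snd @^-1` A); split; [|exact/mem_set|exact/mem_set].
by apply: open_comp => // p _; exact: cvg_snd.
Qed.

(** Pick [x k] outside [U 0], ..., [U k], which do not cover [X]. Points may repeat, but each [U n]
    contains [x k] for finitely many [k] only. *)
Lemma not_countably_compactP (X : topologicalType) : ~ countably_compact X ->
  exists (U : nat -> set X) (x : nat -> X), [/\ forall n, open (U n),
    \bigcup_n U n = [set: X] & forall n k, U n (x k) -> (k < n)%N].
Proof.
move=> /existsNP[U /not_implyP[oU /not_implyP[UT nU]]].
suff /choice[x xP] k : exists x, forall n, (n <= k)%N -> ~ U n x.
  exists U, x; split => // n k Uxk; rewrite ltnNge; apply/negP => nk.
  exact: xP nk Uxk.
apply: contrapT => /forallNP nx; apply: nU.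
exists [fset i in iota 0 k.+1]%fset; first by move=> i _; exact: mem_set.
move=> x _; have /existsNP[n /not_implyP[nk /contrapT Unx]] := nx x.
by exists n => //=; rewrite !inE mem_iota add1n ltnS nk andbT; case: (n).
Qed.

Section EventuallyZero.
Context (X : topologicalType) (R : realType).
Hypothesis tychX : tychonoff_space X.
Variables (U : nat -> set X) (x : nat -> X).
Hypothesis oU : forall n, open (U n).
Hypothesis UT : \bigcup_n U n = [set: X].
Hypothesis Ux : forall n k, U n (x k) -> (k < n)%N.

Let Z := [set f : C_Gamma X R |
  exists n, forall k, (n <= k)%N -> f (x k) = 0].

Let accXR : accessible_space (X * R)%type.
Proof.
by apply: accessible_prod;
  [exact: tychX.1|exact/hausdorff_accessible/Rhausdorff].
Qed.

(** Over [U m] only points with [k < m] are excluded, and finite sets are closed in a T1 space. *)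
Lemma open_avoid_zeros (N : set nat) :
  open [set p : X * R | forall k, N k -> p <> (x k, 0)].
Proof.
rewrite openE => -[y r] yr.
have [m _ Umy] : (\bigcup_n U n) y by rewrite UT.
pose E : set (X * R) := (fun k => (x k, 0)) @` (`I_m `&` N).
have cE : closed E.
  apply: (accessible_finite_set_closed.1 accXR).
  exact/finite_image/finite_setIl/finite_II.
apply: (@filterS _ _ _ ((fst @^-1` U m) `&` ~` E)).
  move=> p [Ump nEp] k Nk pk; apply: nEp; exists k => //; split => //.
  by apply: Ux; rewrite pk in Ump.
apply: open_nbhs_nbhs; split.
  apply: openI; last exact: closed_openC.
  by apply: open_comp => // p _; exact: cvg_fst.
by split => //= -[k [_ Nk] E0]; exact: yr Nk (esym E0).
Qed.

(** A function outside [Z] is nonzero at [x k] for infinitely many [k]; the functions nonzero for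
    all these [k] form a neighbourhood of it disjoint from [Z]. *)
Lemma closed_eventually_zero : closed Z.
Proof.
rewrite -[Z]setCK; apply: open_closedC; rewrite openE => f nZf.
pose N := [set k | f (x k) != 0].
have oW := open_graph_subset (@open_avoid_zeros N).
move: oW; set W := mkset _ => oW; apply: (@filterS _ _ _ W).
  move=> g gN [n gn]; apply: nZf; exists n => k nk; apply/eqP.
  apply: contrapT => /negP fk.
  by have := gN (x k, g (x k)) erefl k fk; rewrite gn.
apply: open_nbhs_nbhs; split => // -[y r] rE k Nk [yE r0].
by move: Nk; rewrite /N/= -yE -[f y]rE r0 eqxx.
Qed.

(** Add to [f] a bump that vanishes off a small neighbourhood [V'] of [x n]. As [V'] lies in some
    [U m], only values at [x k] with [k < m] can change. *)
Lemma perturb_at (f : C_Gamma X R) (W : set (X * R)) n :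
  open W -> graph f `<=` W -> f (x n) = 0 ->
  exists g : C_Gamma X R, [/\ graph g `<=` W, g (x n) != 0 &
    exists m, forall k, (m <= k)%N -> g (x k) = f (x k)].
Proof.
move=> oW fW fxn.
have [V [e [oV Vx e0 VW]]] := open_X_nbhs_rect oW (fW (x n, f (x n)) erefl).
have [m _ Um] : (\bigcup_n U n) (x n) by rewrite UT.
have fc : continuous f := @cts_fun _ _ f.
(* One half of [e] bounds the deviation of [f] from [f (x n)] on [V'], the other the height of the
   bump. *)
have e20 : 0 < e / 2 by rewrite divr_gt0.
pose V' := V `&` U m `&` f @^-1` (ball (f (x n)) (e / 2))°.
have oV' : open V'.
  apply: openI; first exact: openI.
  apply: open_comp; first by move=> ? _; exact: fc.
  exact: open_interior.
have V'x : V' (x n).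
  by split => //; rewrite /preimage/=; apply: nbhs_singleton;
    apply: nbhs_interior; exact: nbhsx_ballx.
(* Complete regularity gives [phi] equal to 0 at [x n] and 1 off [V']; the bump is
   [e / 2 * (1 - phi)]. *)
have := tychX.2 (x n) (~` V') (open_closedC oV') (fun h => h V'x).
move=> /(@uniform_separatorP _ R)[phi [phic phi01 phi0 phi1]].
have gc : continuous (fun y => f y + e / 2 * (1 - phi y)).
  move=> y; apply: cvgD; first exact: fc.
  by apply: cvgM; [exact: cvg_cst|apply: cvgB; [exact: cvg_cst|exact: phic]].
have phiC y : ~ V' y -> phi y = 1 by move=> nVy; apply: phi1; exists y.
exists (mkcts gc : continuousType X R); split.
- move=> [y r] rE; have {r rE}-> : r = f y + e / 2 * (1 - phi y) by exact: rE.
  have [V'y|/phiC ->] := pselect (V' y); last first.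
    by rewrite subrr mulr0 addr0; exact: fW.
  apply: VW; split; first by case: V'y => -[].
  have [_ /interior_subset] := V'y.
  rewrite /ball/= => fy.
  have /andP[p0 p1] : 0 <= phi y <= 1.
    by have := phi01 (phi y); rewrite /= in_itv/=; apply; exists y.
  rewrite opprD addrA (le_lt_trans (ler_normB _ _))//.
  rewrite [ltRHS](splitr e).
  apply: ltr_leD => //; rewrite normrM (gtr0_norm e20) ger0_norm ?subr_ge0//.
  by rewrite ler_piMr ?gerBl// ltW.
- rewrite /= /mkcts fxn (phi0 (phi (x n)))/=; last by exists (x n).
  by rewrite add0r subr0 mulr1 lt0r_neq0.
- exists m => k mk; rewrite /= /mkcts phiC ?subrr ?mulr0 ?addr0//.
  by move=> [[_ /Ux]]; rewrite ltnNge mk.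
Qed.

(** The traces of the [D n] are open and dense in [Z] but have empty intersection, while [Z]
    contains the zero function. *)
Lemma eventually_zero_not_baire : ~ baire_space (set_type Z).
Proof.
pose D n : set (C_Gamma X R) := \bigcup_(k in [set k | (n <= k)%N])
  [set f : C_Gamma X R | graph f `<=` ~` [set (x k, 0)]].
have DP n (f : C_Gamma X R) : D n f <-> exists2 k, (n <= k)%N & f (x k) != 0.
  split=> -[k nk fk]; exists k => //.
    by apply/eqP => fk0; exact: (fk (x k, f (x k)) erefl (congr1 (pair _) fk0)).
  by move=> [y r] rE [yE r0]; move: fk; rewrite -yE -[f y]rE r0 eqxx.
have oD n : open (D n).
  apply: bigcup_open => k _; apply: open_graph_subset; apply: closed_openC.
  exact: accessible_closed_set1.
have Z0 : Z (mkcts (@cst_continuous X R 0) : continuousType X R).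
  by exists 0%N.
pose DZ n : set (set_type Z) := set_val @^-1` D n.
have DZP n : open (DZ n) /\ dense (DZ n).
  split; first by exists (D n).
  move=> O [[f Zf] Of] [O' oO' O'E].
  have {Of}Of : O' f by move: Of; rewrite -O'E.
  have [m fm] : Z f := set_mem Zf.
  have [W oW [fW WO']] := graph_nbhs_base oO' Of.
  (* [k >= m] makes [f] vanish at [x k]; [k >= n] puts the perturbed function in [D n]. *)
  pose k := maxn m n.
  have [|g [gW gk [m' gm']]] := @perturb_at f W k oW fW.
    by apply: fm; exact: leq_maxl.
  have Zg : Z g.
    exists (maxn m m') => j; rewrite geq_max => /andP[mj m'j].
    by rewrite gm'// fm.
  exists (SigSub (mem_set Zg)); split; first by rewrite -O'E; exact: WO'.
  by apply/DP; exists k => //; exact: leq_maxr.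
move=> /(_ DZ DZP setT)[||f [_ fD]]; last 1 first.
- have [n fn] := set_valP f.
  by have /DP[k /fn fk] := fD n I; rewrite fk eqxx.
- by exists (SigSub (mem_set Z0)).
- exact: openT.
Qed.

End EventuallyZero.

Lemma hereditarily_baire_countably_compact (R : realType)
    (X : topologicalType) :
  tychonoff_space X -> hereditarily_baire (C_Gamma X R) -> countably_compact X.
Proof.
move=> tX hb; apply: contrapT => /not_countably_compactP[U [x [oU UT Ux]]].
apply: (eventually_zero_not_baire tX oU UT Ux); apply: hb.
  exact: (closed_eventually_zero tX oU UT Ux).
by exists (mkcts (@cst_continuous X R 0) : continuousType X R), 0%N.
Qed.

(** * The uniform metric on continuous functions *)

Section UniformMetric.
Context (X : topologicalType) (R : realType).

(* The truncation at [1] makes the distance finite with no assumption on [X]. *)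
Definition unif_dist (f g : X -> R) : R :=
  sup (range (fun x => Num.min 1 `|f x - g x|)).

(** The bound [0 <= e] covers empty [X], where the supremum takes its default value 0. *)
Lemma unif_dist_le f g e : 0 <= e ->
  (forall x, Num.min 1 `|f x - g x| <= e) -> unif_dist f g <= e.
Proof.
move=> e0 fge; rewrite /unif_dist.
have [->|/set0P ne] := eqVneq (range (fun x => Num.min 1 `|f x - g x|)) set0.
  by rewrite sup0.
by apply: ge_sup => // _ [x _ <-].
Qed.

Lemma le_unif_dist f g x : Num.min 1 `|f x - g x| <= unif_dist f g.
Proof.
apply: ub_le_sup; last by exists x.
by exists 1 => _ [y _ <-]; rewrite ge_min lexx.
Qed.

Lemma unif_dist_lt f g e x :
  e <= 1 -> unif_dist f g < e -> `|f x - g x| < e.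
Proof.
move=> e1 /(le_lt_trans (le_unif_dist f g x)).
by rewrite gt_min => /orP[/lt_le_trans/(_ e1)|//]; rewrite ltxx.
Qed.

Lemma unif_dist_ge0 f g : 0 <= unif_dist f g.
Proof.
have [E0|/set0P[_ [x _ _]]] :=
    eqVneq (range (fun x => Num.min 1 `|f x - g x|)) set0.
  by rewrite /unif_dist E0 sup0.
by apply: le_trans (le_unif_dist f g x); rewrite le_min ler01 normr_ge0.
Qed.

Lemma unif_distxx f : unif_dist f f = 0.
Proof.
apply/eqP; rewrite eq_le unif_dist_ge0 andbT; apply: unif_dist_le => // x.
by rewrite subrr normr0 min_r.
Qed.

Lemma unif_distC f g : unif_dist f g = unif_dist g f.
Proof.
by rewrite /unif_dist; under [in LHS]eq_fun do rewrite distrC.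
Qed.

Lemma unif_dist_triangle g f h :
  unif_dist f h <= unif_dist f g + unif_dist g h.
Proof.
apply: unif_dist_le => [|x]; first by rewrite addr_ge0 ?unif_dist_ge0.
apply: le_trans (lerD (le_unif_dist f g x) (le_unif_dist g h x)).
have := ler_distD (g x) (f x) (h x).
have := normr_ge0 (f x - g x); have := normr_ge0 (g x - h x).
move: `|f x - g x| `|g x - h x| `|f x - h x| => a b c a0 b0 cab.
by rewrite !minElt; do ?case: ifPn => ?; lra.
Qed.

(** Continuous functions with the uniform metric, not uniformly continuous ones. The carrier is that
    of [C_Gamma X R], so the two topologies can be compared. *)
Definition unif_continuous_fun : Type := continuousType X R.

HB.instance Definition _ :=
  Choice.copy unif_continuous_fun (continuousType X R).

Let unif_dist_eq0 (f g : unif_continuous_fun) : unif_dist f g = 0 -> f = g.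
Proof.
move=> fg; apply/continuousEP => x; apply/eqP; rewrite -subr_eq0 -normr_le0.
have := le_unif_dist f g x; rewrite fg ge_min => /orP[|//].
by rewrite ler10.
Qed.

HB.instance Definition _ := @isMetric.Build R unif_continuous_fun
  (fun f g => unif_dist f g) (fun f => unif_distxx f) unif_dist_eq0
  (fun f g => unif_distC f g) (fun g f h => unif_dist_triangle g f h).

Lemma unif_ballE (f g : unif_continuous_fun) e :
  ball f e g = is_true (unif_dist f g < e).
Proof. by rewrite ballEmdist. Qed.

(** Pointwise limits exist by completeness of [R]. The Cauchy bound is uniform in the point, so
    convergence is uniform and the limit continuous. *)
Lemma unif_cauchy_cvg (F : set_system unif_continuous_fun) :
  ProperFilter F -> cauchy F -> exists f : unif_continuous_fun, F --> f.
Proof.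
move=> PF cF.
have cFe (e : R) : 0 < e -> exists A B, [/\ F A, F B &
    forall f g x, A f -> B g -> `|f x - g x| < e].
  (* Capping the radius at 1 makes [unif_dist_lt] applicable. *)
  move=> e0; have me0 : 0 < Num.min e 1 by rewrite lt_min e0 ltr01.
  have [[A B] /= [FA FB] AB] := (cauchy_ballP F).2 cF _ me0.
  exists A, B; split => // f g x Af Bg.
  have : ball f (Num.min e 1) g by exact: (AB (f, g)).
  rewrite unif_ballE => /(@unif_dist_lt f g _ x)/lt_le_trans; apply.
    by rewrite ge_min lexx orbT.
  by rewrite ge_min lexx.
have cvF x : cvg ((fun f : unif_continuous_fun => f x) @ F).
  apply: cauchy_cvg; apply: (cauchy_ballP _).1 => e e0.
  have [A [B [FA FB AB]]] := cFe e e0.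
  exists ((fun f : unif_continuous_fun => f x) @` A,
          (fun f : unif_continuous_fun => f x) @` B).
    by split; [apply: (@filterS _ F _ A)|apply: (@filterS _ F _ B)] => // f;
      exists f.
  by move=> [_ _] /= [[f Af <-] [g Bg <-]]; exact: AB.
pose h x := lim ((fun f : unif_continuous_fun => f x) @ F).
have Fh (e : R) : 0 < e ->
      F [set f : unif_continuous_fun | forall x, `|h x - f x| < e].
  move=> e0; have e20 : 0 < e / 2 by rewrite divr_gt0.
  have [A [B [FA FB AB]]] := cFe _ e20.
  apply: filterS FA => f Af x.
  have /cvgrPdist_lt/(_ _ e20) hx := cvF x.
  (* [g] depends on [x], but the resulting bound does not. *)
  have [g [Bg hg]] := filter_ex (filterI FB hx).
  rewrite (le_lt_trans (ler_distD (g x) _ _))// (splitr e) ltrD//.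
  by rewrite distrC; exact: AB.
have hc : continuous h.
  move=> x; apply/cvgrPdist_lt => e e0.
  have e30 : 0 < e / 3 by rewrite divr_gt0.
  have [f hf] := filter_ex (Fh _ e30).
  have fc : continuous f := @cts_fun _ _ f.
  have /cvgrPdist_lt/(_ _ e30) := fc x; apply: filterS => y fxy.
  have := hf x; have := hf y; rewrite (distrC (h y)).
  have := ler_distD (f x) (h x) (h y); have := ler_distD (f y) (f x) (h y).
  lra.
exists (mkcts hc : continuousType X R); apply/fcvg_ballP => e e0.
(* A supremum of values below [e / 2] is only at most [e / 2]; halving restores strictness. *)
have e20 : 0 < e / 2 by rewrite divr_gt0.
apply: filterS (Fh _ e20) => f hf; rewrite unif_ballE.
apply: (@le_lt_trans _ _ (e / 2));
  last by rewrite ltr_pdivrMr// ltr_pMr// ltr1n.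
by apply: unif_dist_le => [|x]; [exact: ltW|rewrite ge_min (ltW (hf x)) orbT].
Qed.

(** [S n] collects the points over which the vertical radius [1 / (n + 1)] fits in [W]; by
    continuity of [f] the interiors cover [X]. *)
Lemma countably_compact_tube (f : C_Gamma X R) (W : set (X * R)) :
  countably_compact X -> open W -> graph f `<=` W ->
  exists2 e : R, 0 < e & forall x t, `|f x - t| < e -> W (x, t).
Proof.
move=> cX oW fW.
pose S n := [set x | forall t, `|f x - t| < n.+1%:R^-1 -> W (x, t)].
have [||D _ DS] := cX (fun n => (S n)°).
- by move=> n; exact: open_interior.
- apply/seteqP; split => // x _.
  have [V [e [oV Vx e0 VW]]] := open_X_nbhs_rect oW (fW (x, f x) erefl).
  have e20 : 0 < e / 2 by rewrite divr_gt0.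
  have [n _ /(_ n (leqnn n)) ne] := near_infty_natSinv_lt (PosNum e20).
  exists n => //; rewrite /interior.
  have fc : continuous f := @cts_fun _ _ f.
  have /cvgrPdist_lt/(_ _ e20) := fc x.
  have : nbhs x V by exact: open_nbhs_nbhs.
  apply: filterS2 => y Vy fxy t fyt; apply: VW; split => //.
  rewrite /ball/= (le_lt_trans (ler_distD (f y) _ _))// (splitr e) ltrD//.
  exact: lt_trans fyt ne.
(* The largest index of the finite subcover gives the smallest radius; an empty [D] gives radius 1,
   and then [X] is empty. *)
exists ((\max_(i <- D) i).+1%:R^-1) => // x t fxt.
have [i Di /interior_subset] := DS x I; apply.
apply: lt_le_trans fxt _; rewrite lef_pV2 ?posrE// ler_nat ltnS.
exact: leq_bigmax_seq.
Qed.

(** An open vertical tube around a graph defines a graph-open set inside a uniform ball; conversely,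
    [countably_compact_tube] fits a uniform ball into a basic graph-open set. *)
Lemma open_unifE : countably_compact X ->
  @open unif_continuous_fun = @open (C_Gamma X R).
Proof.
move=> cX; apply/seteqP; split => O oO.
  rewrite openE => f Of.
  have /nbhs_ballP[e /= e0 fO] := open_nbhs_nbhs (conj oO Of).
  have e20 : 0 < e / 2 by rewrite divr_gt0.
  pose W := [set p : X * R | `|f p.1 - p.2| < e / 2].
  have oW : open W.
    apply: (@open_comp _ _ (fun p : X * R => `|f p.1 - p.2|)
      [set r | r < e / 2]).
      move=> p _; apply: cvg_norm; apply: cvgB; last exact: cvg_snd.
      by apply: (@cvg_comp _ _ _ fst f); [exact: cvg_fst|exact: cts_fun].
    exact: open_lt.
  apply: (@filterS _ _ _ [set g : C_Gamma X R | graph g `<=` W]).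
    move=> g gW; apply: fO; rewrite unif_ballE.
    apply: (@le_lt_trans _ _ (e / 2)).
      apply: unif_dist_le => [|x]; first exact: ltW.
      have /ltW fg : `|f x - g x| < e / 2 := gW (x, g x) erefl.
      by rewrite ge_min fg orbT.
    by rewrite ltr_pdivrMr// ltr_pMr// ltr1n.
  apply: open_nbhs_nbhs; split; first exact: open_graph_subset.
  by move=> [x r] rE; rewrite /W/= (rE : r = f x) subrr normr0.
rewrite openE => f Of.
have [W oW [fW WO]] := graph_nbhs_base oO Of.
have [e e0 eW] := countably_compact_tube cX oW fW.
apply/nbhs_ballP; exists (Num.min e 1); first by rewrite /= lt_min e0 ltr01.
move=> g; rewrite unif_ballE => fg; apply: WO => -[x r] rE.
apply: eW; rewrite (rE : r = g x).
have := @unif_dist_lt f g _ x _ fg; rewrite ge_min lexx orbT => /(_ isT).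
by move=> /lt_le_trans; apply; rewrite ge_min lexx.
Qed.

Lemma countably_compact_completely_metrizable :
  countably_compact X -> completely_metrizable R (C_Gamma X R).
Proof.
move=> cX; exists (Metric.class unif_continuous_fun); split.
  exact: open_unifE.
exact: unif_cauchy_cvg.
Qed.

End UniformMetric.

Theorem theorem2p1 (R : realType) (X : topologicalType)
    (hX : tychonoff_space X) :
  [<-> completely_metrizable R (C_Gamma X R);
       cech_complete (C_Gamma X R);
       sieve_complete (C_Gamma X R);
       hereditarily_baire (C_Gamma X R);
       countably_compact X].
Proof.
tfae.
- exact: completely_metrizable_cech_complete.
(* A Cech complete space is its own image under the identity. *)
- move=> cC; exists (C_Gamma X R), id; split => //.
  + by move=> f; exact: cvg_id.
  + by move=> A oA; rewrite image_id.
  + by rewrite image_id.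
- exact: sieve_complete_hereditarily_baire.
- exact: hereditarily_baire_countably_compact.
- exact: countably_compact_completely_metrizable.
Qed.
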